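(* Let $X$, $Y$, $Z$ be related by the structural equations $$Y=\sum_{j=0}^n I(X=x_j)\,U_j,\qquad X=V(Z)\ \ (\text{i.e. } X(\omega)=V(Z(\omega))(\omega)).$$ Suppose $Z$ is independent of the collection $\{V(z),\,z\in[0,1];\,U_0,\dots,U_n\}$ and that the functions $\mu,q_1,\dots,q_n$ are differentiable in $z\in[0,1]$. Assume also that (i) for all sufficiently small $\delta$, all $z\in[0,1]$ (with $z+\delta\in[0,1]$) and all $j=1,\dots,n$, the variables $\Delta_{j0}Y$ and $\Delta_{z,\delta}I_j(X)$ have zero correlation; (ii) the functions $a_1(z),\dots,a_n(z)$ on $[0,1]$ are linearly independent. Then the vector of causal effects $\theta=(\theta_1,\dots,\theta_n)$, $\theta_j=E(U_j-U_0)$, is identifiable via the equation $$b(z)=\sum_{j=1}^n\theta_j\,a_j(z),\qquad z\in[0,1];$$ that is, $\theta$ satisfies this equation for all $z\in[0,1]$ and is the unique vector in $\mathbb{R}^n$ that does so.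
   Context: All random variables are defined on a probability space $(\Omega,\mathcal{A},P)$. $X$ takes values in a finite set $\{x_0,\dots,x_n\}$ of distinct points, $Z$ takes values in $[0,1]$, and $U_0,\dots,U_n$ (hence $Y$) are real-valued and integrable. $\{V(z),z\in[0,1]\}$ is a (jointly measurable in $(z,\omega)$) collection of random variables with values in $\{x_0,\dots,x_n\}$, and $P(V(z)=x_j\mid Z=z)=q_j(z)$ for $j=1,\dots,n$. No restriction is imposed on the joint distribution of the $U_j$'s and $V(z)$'s beyond those in the claim. $I(\cdot)$ denotes the indicator of an event. Notation: - $\Delta_{j0}Y=U_j-U_0$ (change in $Y$ caused by changing $X$ from $x_0$ to $x_j$). - $I(X)$ is the $n$-vector whose $j$-th component is $I_j(X)=I(X=x_j)$, $j=1,\dots,n$. - $\Delta_{z,\delta}I_j(X)=I(V(z+\delta)=x_j)-I(V(z)=x_j)$ (change in $I_j(X)$ when $Z$ is increased from $z$ by $\delta$). - $\mu(z)=E(Y\mid Z=z)$ and $b(z)=\frac{d}{dz}\mu(z)$. - $a(z)=(a_1(z),\dots,a_n(z))=\frac{d}{dz}E(I(X)\mid Z=z)=\frac{d}{dz}q(z)$, where $q=(q_1,\dots,q_n)$. - Two variables $B,C$ have zero correlation if $E(BC)=E(B)E(C)$. Convention on conditioning: since $Z$ is independent of $\{V(z)\},U_0,\dots,U_n$, conditional expectations and probabilities given $Z=z$ are, for every $z\in[0,1]$, those obtained by substituting $z$ for $Z$; thus $E(Y\mid Z=z)=E\big(\sum_{j=0}^n I(V(z)=x_j)U_j\big)$ and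 $P(X=x_j\mid Z=z)=P(V(z)=x_j)=q_j(z)$. One-sided derivatives are used at the endpoints of $[0,1]$. *)

(* Defs.v *)
From HB Require Import structures.
From mathcomp Require Export all_boot all_order all_algebra.
From mathcomp Require Export all_classical all_reals all_analysis.
Export Order.TTheory GRing.Theory Num.Theory numFieldNormedType.Exports.

Set Implicit Arguments.
Unset Strict Implicit.
Unset Printing Implicit Defensive.

Local Open Scope classical_set_scope.
Local Open Scope ring_scope.

Definition unit_itv (R : realType) : set R := [set` `[0, 1]].

(* The increment [h] is restricted to [D z+h], so on a closed interval these
   are the usual derivatives inside and the one-sided ones at the endpoints. *)
Definition diff_quot (R : realType) (f : R -> R) (z h : R) : R :=
  h^-1 * (f (z + h) - f z).

Definition derivable_in (R : realType) (D : set R) (f : R -> R) (z : R) : Prop :=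
  cvg (diff_quot f z @ within [set h | D (z + h)] 0^').

Definition derive_in (R : realType) (D : set R) (f : R -> R) (z : R) : R :=
  lim (diff_quot f z @ within [set h | D (z + h)] 0^').

Definition lin_indep_on (R : realType) (D : set R) (n : nat)
    (f : 'I_n -> R -> R) : Prop :=
  forall c : 'I_n -> R,
    (forall z, D z -> \sum_(j < n) c j * f j z = 0) -> forall j, c j = 0.

Definition independent_systems d (T : measurableType d) (R : realType)
    (P : probability T R) (F G : set (set T)) : Prop :=
  forall A B, F A -> G B -> P (A `&` B) = (P A * P B)%E.

Definition zero_corr d (T : measurableType d) (R : realType)
    (P : probability T R) (B C : T -> R) : Prop :=
  ('E_P[B \* C] = 'E_P[B] * 'E_P[C])%E.

Section model.
Context d (T : measurableType d) (R : realType) (P : probability T R).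
(* [x 0, ..., x n] are the points; [lift ord0 j], for [j : 'I_n], runs over the
   indices [1, ..., n], so coordinate [j] of an [n]-vector is about [x_(j+1)]. *)
Variables (E : Type) (n : nat) (x : 'I_n.+1 -> E).
Implicit Types (U : 'I_n.+1 -> T -> R) (V : R -> T -> E) (X : T -> E).

(* No sigma-algebra is put on [E]: a variable with values in [{x_0, ..., x_n}]
   is described by its events [X = x_j]. *)
Definition ind X (j : 'I_n.+1) : T -> R := \1_(X @^-1` [set x j]).

Definition outcome U X (w : T) : R := \sum_(j < n.+1) ind X j w * U j w.

Definition jointly_measurable V : Prop :=
  forall j, measurable
    [set p : R * T | unit_itv p.1 /\ V p.1 p.2 = x j].

Definition sigma_rv (Z : T -> R) : set (set T) :=
  preimage_set_system setT Z measurable.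

Definition sigma_VU V U : set (set T) :=
  <<s [set C | (exists z j, unit_itv z /\ C = V z @^-1` [set x j])
            \/ (exists j, sigma_rv (U j) C)] >>.

(* For [Z] independent of the random function [phi], the conditional mean of
   [phi (Z w) w] given [Z = z], in the version obtained by substituting [z] for
   [Z]. *)
Definition cond_mean (phi : R -> T -> R) (z : R) : R := fine 'E_P[phi z].

Definition mu V U : R -> R := cond_mean (fun z => outcome U (V z)).

Definition q V (j : 'I_n) (z : R) : R :=
  fine (P (V z @^-1` [set x (lift ord0 j)])).

Definition b V U : R -> R := derive_in (@unit_itv R) (mu V U).

Definition a V (j : 'I_n) : R -> R := derive_in (@unit_itv R) (q V j).

Definition DeltaY U (j : 'I_n) : T -> R :=
  fun w => U (lift ord0 j) w - U ord0 w.

Definition DeltaI V (z delta : R) (j : 'I_n) : T -> R :=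
  fun w => ind (V (z + delta)) (lift ord0 j) w - ind (V z) (lift ord0 j) w.

Definition theta U : 'rV[R]_n := \row_j fine 'E_P[DeltaY U j].

End model.

(* Main.v *)
(** The indicators of [X = x_j] sum to 1, so
    [Y = U_0 + sum_j I_j(X) (U_j - U_0)], and an increment of [mu] is
    [sum_j E ((U_j - U_0) Delta I_j)].  Zero correlation makes this
    [sum_j theta_j Delta q_j] for every small increment; dividing by the
    increment and passing to the limit gives [b = sum_j theta_j a_j].
    Uniqueness is the linear independence of the [a_j]. *)

Require Import Defs.
From mathcomp Require Import lra.

Set Implicit Arguments.
Unset Strict Implicit.
Unset Printing Implicit Defensive.

Local Open Scope classical_set_scope.
Local Open Scope ring_scope.

(* Without this, the limit defining [derive_in] would be a junk value. *)
Lemma within_unit_itv_proper (R : realType) (z : R) : unit_itv z ->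
  ProperFilter (within [set h | unit_itv (z + h)] (0 : R)^').
Proof.
rewrite /unit_itv /= in_itv /= => /andP[z0 z1].
apply: Build_ProperFilter_ex => Q [e /= e0 Qe].
(* Halving [e] puts [r] strictly inside the ball. Since [r <= 1 / 2], a step of [r] to the right
   from the left half of the interval, or to the left from the right half, stays in the interval;
   this covers both endpoints. *)
pose r := Num.min (e / 2) (1 / 2).
have r0 : 0 < r by rewrite lt_min !divr_gt0.
have re : r < e by rewrite gt_min ltr_pdivrMr ?ltr_pMr ?ltr1n.
have r2 : r <= 1 / 2 by rewrite ge_min lexx orbT.
pose h := if z <= 1 / 2 then r else - r.
exists h; apply: Qe => /=.
- by rewrite /h sub0r normrN; case: ifP => _; rewrite ?normrN gtr0_norm.
- by rewrite /h; case: ifP => _; rewrite ?oppr_eq0 gt_eqF.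
- rewrite /unit_itv /= in_itv /= /h; case: ifP => hz; apply/andP; split; lra.
Qed.

(** Along the filter of admissible increments, the difference quotient of [f] eventually coincides
    with the same combination of those of the [g j], which converges by linearity of limits. *)
Lemma derive_in_lincomb (R : realType) (n : nat) (c : 'I_n -> R)
    (g : 'I_n -> R -> R) (f : R -> R) (z : R) :
  unit_itv z ->
  (forall j, derivable_in (@unit_itv R) (g j) z) ->
  (\forall h \near (0 : R), unit_itv (z + h) ->
     f (z + h) - f z = \sum_(j < n) c j * (g j (z + h) - g j z)) ->
  derive_in (@unit_itv R) f z =
  \sum_(j < n) c j * derive_in (@unit_itv R) (g j) z.
Proof.
move=> Dz gD fg; have FF := within_unit_itv_proper Dz.
apply: cvg_lim; first exact: norm_hausdorff.
have gl : \sum_(j < n) c j * diff_quot (g j) z h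
    @[h --> within [set h | unit_itv (z + h)] (0 : R)^']
    --> \sum_(j < n) c j * derive_in (@unit_itv R) (g j) z.
  apply: cvg_big; first exact: add_continuous.
  by move=> j _; apply: cvgMr; exact: gD.
apply: cvg_trans gl; apply: near_eq_cvg.
have fg' : \forall h \near (0 : R)^', unit_itv (z + h) ->
    f (z + h) - f z = \sum_(j < n) c j * (g j (z + h) - g j z).
  exact: cvg_within fg.
(* [within] unfolds to an implication, which supplies the premise that [z + h] lies in the
   interval. *)
apply: filterS fg' => h /[apply] /=; rewrite /diff_quot => ->.
by rewrite mulr_sumr; apply: eq_bigr => j _; rewrite mulrCA.
Qed.

Section model.
Context d (T : measurableType d) (R : realType) (P : probability T R).
Variables (E : Type) (n : nat) (x : 'I_n.+1 -> E).
Implicit Types (U : 'I_n.+1 -> T -> R) (V : R -> T -> E) (X : T -> E).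

(** The event is the section at [z] of a jointly measurable set. *)
Lemma measurable_event V z j : jointly_measurable x V -> unit_itv z ->
  measurable (V z @^-1` [set x j]).
Proof.
move=> mV Dz; have := measurable_xsection z (mV j); rewrite xsectionE.
by congr (measurable _); apply/seteqP; split=> w /= => [[]|].
Qed.

Lemma sum_ind X w : injective x -> (exists j, X w = x j) ->
  \sum_(j < n.+1) ind R x X j w = 1 :> R.
Proof.
move=> x_inj [k Xk]; rewrite (bigD1 k)//= big1 => [|j jk].
  by rewrite addr0 /ind indicE mem_set.
rewrite /ind indicE memNset //= => Xj.
by move/eqP: jk; apply; apply: x_inj; rewrite -Xk -Xj.
Qed.

Lemma outcomeE U X w : injective x -> (exists j, X w = x j) ->
  outcome x U X w =
  U ord0 w + \sum_(j < n) ind R x X (lift ord0 j) w * DeltaY U j w.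
Proof.
move=> x_inj Xw; have := @sum_ind X w x_inj Xw.
(* Solves the sum of the indicators for the one at [ord0] and substitutes it. *)
rewrite /outcome !big_ord_recl /= => /(canRL (addrK _)) ->.
rewrite mulrBl mul1r mulr_suml -addrA; congr (_ + _).
rewrite addrC -sumrB; apply: eq_bigr => j _.
by rewrite /DeltaY mulrBr.
Qed.

(** An indicator is measurable and bounded by 1, so multiplying by it preserves integrability. *)
Lemma Lfun1_ind_mul (f : T -> R) X j : measurable (X @^-1` [set x j]) ->
  f \in Lfun P 1 -> (ind R x X j \* f)%R \in Lfun P 1.
Proof.
move=> mX /Lfun1_integrable fi; apply/Lfun1_integrable.
apply: (integrableMr _ (h := ind R x X j) (g := EFin \o f)) => //.
  exact: measurable_realfun.measurable_indic.
exists 1; split => // M M1 w _ /=.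
by rewrite /ind indicE (le_trans _ (ltW M1))// normr_nat lern1 leq_b1.
Qed.

Lemma mu_increment U V z h :
  injective x -> (forall j, P.-integrable setT (EFin \o U j)) ->
  (forall z w, unit_itv z -> exists j, V z w = x j) ->
  jointly_measurable x V -> unit_itv z -> unit_itv (z + h) ->
  (forall j, zero_corr P (DeltaY U j) (DeltaI x V z h j)) ->
  mu P x V U (z + h) - mu P x V U z =
  \sum_(j < n) theta P U ord0 j * (q P x V j (z + h) - q P x V j z).
Proof.
move=> x_inj U_int V_val mV Dz Dzh corr.
have UL j : U j \in Lfun P 1 by apply/Lfun1_integrable.
have YL j : DeltaY U j \in Lfun P 1 by exact: rpredB.
have IL v j : unit_itv v -> ind R x (V v) j \in Lfun P 1.
  by move=> Dv; apply/Lfun1_integrable/integrable_indic/measurable_event.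
have IUL v j f : unit_itv v -> f \in Lfun P 1 ->
    (ind R x (V v) j \* f)%R \in Lfun P 1.
  by move=> Dv fL; apply: Lfun1_ind_mul => //; exact: measurable_event.
have OL v : unit_itv v -> outcome x U (V v) \in Lfun P 1.
  move=> Dv.
  have -> : outcome x U (V v) = \sum_(j < n.+1) (ind R x (V v) j \* U j)%R.
    by apply/funext => w; rewrite fct_sumE.
  by apply: rpred_sum => // j _; exact: IUL.
rewrite /mu /cond_mean -fineB ?expectation_fin_num ?OL//.
rewrite -expectationB ?OL//.
have -> : (outcome x U (V (z + h)) \- outcome x U (V z))%R =
    \sum_(j < n) (DeltaY U j \* DeltaI x V z h j)%R.
  apply/funext => w; rewrite fct_sumE /= !outcomeE//; try exact: V_val.
  (* The two copies of [U ord0] cancel here. *)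
  rewrite opprD addrACA subrr add0r -sumrB; apply: eq_bigr => j _.
  by rewrite -mulrBl mulrC.
(* Integrability of both factors would not suffice for the product; it is split into two products
   with a bounded indicator. *)
have DL j : (DeltaY U j \* DeltaI x V z h j)%R \in Lfun P 1.
  have -> : (DeltaY U j \* DeltaI x V z h j)%R =
      ((ind R x (V (z + h)) (lift ord0 j) \* DeltaY U j) \-
       (ind R x (V z) (lift ord0 j) \* DeltaY U j))%R.
    by apply/funext => w /=; rewrite -mulrBl mulrC.
  by apply: rpredB => //; exact: IUL.
have -> : ('E_P[\sum_(j < n) (DeltaY U j \* DeltaI x V z h j)%R] =
    \sum_(j < n) 'E_P[DeltaY U j \* DeltaI x V z h j])%E.
  (* [expectation_sum] ranges over a list of functions, hence the reindexing. *)
  rewrite -(big_map (fun j => DeltaY U j \* DeltaI x V z h j) xpredT id).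
  rewrite expectation_sum ?big_map// => f /mapP[j _ ->]; exact: DL.
rewrite -sum_fine => [|j _]; last exact: expectation_fin_num.
(* After the factorization by [corr], finiteness of both expectations lets [fine] pass through the
   product. *)
apply: eq_bigr => j _; rewrite corr /theta mxE.
have DIE : ('E_P[DeltaI x V z h j] =
    P (V (z + h)%R @^-1` [set x (lift ord0 j)]) -
     P (V z @^-1` [set x (lift ord0 j)]))%E.
  rewrite expectationB ?IL// !expectation_indic//; exact: measurable_event.
rewrite DIE fineM ?expectation_fin_num//.
  by rewrite fineB ?fin_num_measure//; exact: measurable_event.
by rewrite fin_numB !fin_num_measure//; exact: measurable_event.
Qed.

End model.

Theorem theorem2 (d : measure_display) (T : measurableType d) (R : realType)
    (P : probability T R) (E : Type) (n : nat) (x : 'I_n.+1 -> E)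
    (X : T -> E) (Y : T -> R) (Z : {RV P >-> R})
    (U : 'I_n.+1 -> T -> R) (V : R -> T -> E)
    (x_inj : injective x)
    (Z01 : forall w, unit_itv (Z w))
    (U_int : forall j, P.-integrable setT (EFin \o U j))
    (V_val : forall z w, unit_itv z -> exists j, V z w = x j)
    (V_meas : jointly_measurable x V)
    (Y_eq : forall w, Y w = outcome x U X w)
    (X_eq : forall w, X w = V (Z w) w)
    (Z_indep : independent_systems P (sigma_rv Z) (sigma_VU x V U))
    (mu_diff : forall z, unit_itv z ->
       derivable_in (@unit_itv R) (mu P x V U) z)
    (q_diff : forall (j : 'I_n) z, unit_itv z ->
       derivable_in (@unit_itv R) (q P x V j) z)
    (uncorrelated : \forall delta \near (0 : R), forall z (j : 'I_n),
       unit_itv z -> unit_itv (z + delta) ->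
       zero_corr P (DeltaY U j) (DeltaI x V z delta j))
    (a_indep : lin_indep_on (@unit_itv R) (a P x V)) :
  (forall z, unit_itv z ->
     b P x V U z = \sum_(j < n) theta P U ord0 j * a P x V j z) /\
  (forall t : 'rV[R]_n,
     (forall z, unit_itv z ->
        b P x V U z = \sum_(j < n) t ord0 j * a P x V j z) ->
     t = theta P U).
Proof.
have thetaP z : unit_itv z ->
    b P x V U z = \sum_(j < n) theta P U ord0 j * a P x V j z.
  move=> Dz; apply: derive_in_lincomb => //; first by move=> j; exact: q_diff.
  apply: filterS uncorrelated => h corr Dzh.
  by apply: mu_increment => // j; exact: corr.
split=> // t tP; apply/rowP => j; apply/eqP; rewrite -subr_eq0; apply/eqP.
(* Both [t] and [theta] represent [b], so their difference gives a vanishing combination of the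
   [a_j]. *)
apply: (a_indep (fun j => t ord0 j - theta P U ord0 j)) => z Dz.
under eq_bigr do rewrite mulrBl.
by rewrite sumrB -tP// -thetaP// subrr.
Qed.
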